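(* Let $(M,g)$ be a Hopf hypersurface of a Kaehler-like statistical manifold. Then $\xi$ is a geodesic vector field with respect to $\nabla$ if and only if $\theta(\xi)=0$.
   Context: Hermite-like statistical manifold: a semi-Riemannian manifold $(\widetilde M,\widetilde g)$ with two almost complex structures $J,J^{\ast}$ ($J^2=(J^{\ast})^2=-I$) satisfying $\widetilde g(JX,Y)=-\widetilde g(X,J^{\ast}Y)$ for all vector fields $X,Y$, and an affine connection $\widetilde\nabla$ such that $\widetilde\nabla\widetilde g$ is symmetric. The dual connection $\widetilde\nabla^{\ast}$ is defined by $Z\,\widetilde g(X,Y)=\widetilde g(\widetilde\nabla_ZX,Y)+\widetilde g(X,\widetilde\nabla^{\ast}_ZY)$, and $\frac12(\widetilde\nabla+\widetilde\nabla^{\ast})$ is the Levi-Civita connection of $\widetilde g$. It is Kaehler-like if $\widetilde\nabla J=0$ (then also $\widetilde\nabla^{\ast}J^{\ast}=0$). Tangential hypersurface: a non-degenerate hypersurface $(M,g)$, $g$ the induced metric, with unit normal field $N$, such that $JN$ and $J^{\ast}N$ are tangent to $M$. Put $\xi=-JN$, $\xi^{\ast}=-J^{\ast}N$, $\varepsilon=g(\xi,\xi^{\ast})$. Gauss and Weingarten formulas, for $X,Y$ tangent to $M$: $\widetilde\nabla_XY=\nabla_XY+\varepsilon g(A^{\ast}_NX,Y)N$, $\ \widetilde\nabla_XN=-A_NX+\varepsilon\theta(X)N$, $\widetilde\nabla^{\ast}_XY=\nabla^{\ast}_XY+\varepsilon g(A_NX,Y)N$, $\ \widetilde\nabla^{\ast}_XN=-A^{\ast}_NX-\varepsilon\theta(X)N$,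 where $\nabla,\nabla^{\ast}$ are the induced connections on $M$, $A_N,A_N^{\ast}$ the shape operators and $\theta$ a 1-form on $M$. Hopf hypersurface: a tangential hypersurface for which there are smooth functions $\rho,\rho^{\ast}$ with $A_N\xi=\rho\xi$ and $A^{\ast}_N\xi^{\ast}=\rho^{\ast}\xi^{\ast}$. A vector field $X$ is called geodesic with respect to a connection $D$ if there is a smooth function $\zeta$ with $D_XX=\zeta X$; if $\zeta=0$, $X$ is called a unit geodesic vector field.
   Formalization: ''Geodesic'' is taken as ∇_ξ ξ = 0 (ζ = 0, ''unit geodesic''); with the definition ∇_ξ ξ = ζξ for some smooth ζ the claim is false, since ∇_ξ ξ = εθ(ξ)ξ holds on every Hopf hypersurface while θ(ξ) need not vanish. *)

(* Defs.v *)
From HB Require Import structures.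
From mathcomp Require Import all_boot all_order all_algebra.
From mathcomp Require Import all_classical all_reals all_analysis.

Set Implicit Arguments.
Unset Strict Implicit.
Unset Printing Implicit Defensive.

Import Order.TTheory GRing.Theory Num.Theory numFieldNormedType.Exports.

Local Open Scope classical_set_scope.
Local Open Scope ring_scope.

Section SmoothCalculus.
Variables (R : realType) (n : nat) (V : normedModType R).

Fixpoint Ck (k : nat) (U : set 'rV[R]_n) (f : 'rV[R]_n -> V) : Prop :=
  match k with
  | 0 => forall x, U x -> {for x, continuous f}
  | k'.+1 => (forall x, U x -> differentiable f x) /\
             (forall v, Ck k' U (fun x => 'D_v f x))
  end.

Definition smooth_on (U : set 'rV[R]_n) (f : 'rV[R]_n -> V) : Prop :=
  forall k, Ck k U f.

Definition smooth_near (x : 'rV[R]_n) (f : 'rV[R]_n -> V) : Prop :=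
  exists2 U, open_nbhs x U & smooth_on U f.

End SmoothCalculus.

(* The atlas is indexed by the points of the manifold: [coord p] is a chart
   whose domain contains [p]. Any smooth structure has such an atlas (choose a
   chart around every point), and it determines the smooth structure. *)
Record manifold (R : realType) (n : nat) := Manifold {
  space :> topologicalType;
  space_hausdorff : hausdorff_space space;
  space_second_countable : @second_countable space;
  dom : space -> set space;
  coord : space -> space -> 'rV[R]_n;
  param : space -> 'rV[R]_n -> space;
  dom_open : forall p, open (dom p);
  dom_mem : forall p, dom p p;
  coord_open : forall p, open (coord p @` dom p);
  coordK : forall p q, dom p q -> param p (coord p q) = q;
  coord_continuous : forall p q, dom p q -> {for q, continuous (coord p)};
  param_continuous : forall p x,
    (coord p @` dom p) x -> {for x, continuous (param p)};
  transition_smooth : forall p q,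
    smooth_on (coord p @` (dom p `&` dom q)) (coord q \o param p)
}.

Section Fields.
Variables (R : realType) (n : nat) (M : manifold R n).

Definition smooth_fun_at (V : normedModType R) (p : M) (f : M -> V) : Prop :=
  smooth_near (coord p p) (f \o param p).

(* A tangent vector at [p] is the row of its components with respect to the
   chart [coord p] attached to [p]; so T_pM is the type 'rV[R]_n, and a vector
   field is a function M -> 'rV[R]_n read in this way. *)
Definition vfield := M -> 'rV[R]_n.

(* v(f), for v in T_pM *)
Definition dird (V : normedModType R) (p : M) (v : 'rV[R]_n) (f : M -> V) : V :=
  'D_v (f \o param p) (coord p p).

(* Components in the chart [coord p] of the vector v in T_qM, q in [dom p]. *)
Definition tcoord (p q : M) (v : 'rV[R]_n) : 'rV[R]_n := dird q v (coord p).

(* \sum_i w_i d/dx_i, for the coordinates x_i of the chart [coord p]; only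
   meaningful on [dom p]. *)
Definition coord_field (p : M) (w : 'rV[R]_n) : vfield :=
  fun q => 'D_w (coord q \o param p) (coord p q).

Definition smooth_vfield_at (p : M) (X : vfield) : Prop :=
  smooth_fun_at p (fun q => tcoord p q (X q)).

Definition smooth_vfield (X : vfield) : Prop :=
  forall p, smooth_vfield_at p X.

Definition smooth_scalar (f : M -> R^o) : Prop := forall p, smooth_fun_at p f.

Definition one_form (theta : M -> 'rV[R]_n -> R) : Prop :=
  (forall p (a : R) u v, theta p (a *: u + v) = a * theta p u + theta p v) /\
  (forall p X, smooth_vfield_at p X ->
     smooth_fun_at p (fun q => theta q (X q) : R^o)).

Definition endo_field (T : M -> 'rV[R]_n -> 'rV[R]_n) : Prop :=
  (forall p (a : R) u v, T p (a *: u + v) = a *: T p u + T p v) /\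
  (forall p X, smooth_vfield_at p X ->
     smooth_vfield_at p (fun q => T q (X q))).

Definition sym_tensor (g : M -> 'rV[R]_n -> 'rV[R]_n -> R) : Prop :=
  [/\ forall p (a : R) u v w, g p (a *: u + v) w = a * g p u w + g p v w,
      forall p u v, g p u v = g p v u
    & forall p X Y, smooth_vfield_at p X -> smooth_vfield_at p Y ->
        smooth_fun_at p (fun q => g q (X q) (Y q) : R^o)].

Definition nondegenerate (g : M -> 'rV[R]_n -> 'rV[R]_n -> R) : Prop :=
  forall p u, (forall v, g p u v = 0) -> u = 0.

Definition neg_subspace (g : M -> 'rV[R]_n -> 'rV[R]_n -> R) (p : M) (k : nat) :=
  exists W : 'M[R]_(k, n), forall u, u != 0 -> g p (u *m W) (u *m W) < 0.

Definition semi_riemannian (g : M -> 'rV[R]_n -> 'rV[R]_n -> R) : Prop :=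
  [/\ sym_tensor g, nondegenerate g
    & exists k, forall p, neg_subspace g p k /\ ~ neg_subspace g p k.+1].

(* [D p v Y] is D_v Y in T_pM, for v in T_pM. Only fields Y that are smooth near
   p matter. Because the Leibniz rule is imposed for fields and functions that
   are merely smooth near p, D_v Y depends only on the germ of Y at p. An affine
   connection on the global vector fields extends uniquely to such germs. *)
Definition covder := forall p : M, 'rV[R]_n -> vfield -> 'rV[R]_n.

Definition connection (D : covder) : Prop :=
  [/\ forall p Y (a : R) u v, smooth_vfield_at p Y ->
        D p (a *: u + v) Y = a *: D p u Y + D p v Y,
      forall p v Y Z, smooth_vfield_at p Y -> smooth_vfield_at p Z ->
        D p v (fun q => Y q + Z q) = D p v Y + D p v Z,
      forall p v (f : M -> R^o) Y, smooth_fun_at p f -> smooth_vfield_at p Y ->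
        D p v (fun q => f q *: Y q) = dird p v f *: Y p + f p *: D p v Y
    & forall p X Y, smooth_vfield_at p X -> smooth_vfield_at p Y ->
        smooth_vfield_at p (fun q => D q (X q) Y)].

(* (D_X Y - D_Y X) f = X (Y f) - Y (X f) *)
Definition torsion_free (D : covder) : Prop :=
  forall p X Y (f : M -> R^o),
    smooth_vfield_at p X -> smooth_vfield_at p Y -> smooth_fun_at p f ->
    dird p (D p (X p) Y - D p (Y p) X) f =
    dird p (X p) (fun q => dird q (Y q) f) -
    dird p (Y p) (fun q => dird q (X q) f).

(* ((D_X g)(Y, Z))(p) *)
Definition covder_metric (D : covder) (g : M -> 'rV[R]_n -> 'rV[R]_n -> R)
    (p : M) (X Y Z : vfield) : R :=
  dird p (X p) (fun q => g q (Y q) (Z q) : R^o)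
  - g p (D p (X p) Y) (Z p) - g p (Y p) (D p (X p) Z).

Definition levi_civita (g : M -> 'rV[R]_n -> 'rV[R]_n -> R) (D : covder) : Prop :=
  [/\ connection D, torsion_free D
    & forall p X Y Z,
        smooth_vfield_at p X -> smooth_vfield_at p Y -> smooth_vfield_at p Z ->
        covder_metric D g p X Y Z = 0].

Definition dual_connection (g : M -> 'rV[R]_n -> 'rV[R]_n -> R)
    (D DS : covder) : Prop :=
  connection DS /\
  forall p Z X Y,
    smooth_vfield_at p Z -> smooth_vfield_at p X -> smooth_vfield_at p Y ->
    dird p (Z p) (fun q => g q (X q) (Y q) : R^o) =
    g p (D p (Z p) X) (Y p) + g p (X p) (DS p (Z p) Y).

(* (g, D) is a statistical structure, with dual connection DS. The third
   condition makes D g totally symmetric, since g is symmetric. *)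
Definition statistical (g : M -> 'rV[R]_n -> 'rV[R]_n -> R)
    (D DS : covder) : Prop :=
  [/\ semi_riemannian g,
      connection D,
      forall p X Y Z,
        smooth_vfield_at p X -> smooth_vfield_at p Y -> smooth_vfield_at p Z ->
        covder_metric D g p X Y Z = covder_metric D g p Y X Z,
      dual_connection g D DS
    & levi_civita g (fun p v Y => 2^-1 *: (D p v Y + DS p v Y))].

Definition almost_complex (J : M -> 'rV[R]_n -> 'rV[R]_n) : Prop :=
  endo_field J /\ forall p v, J p (J p v) = - v.

Definition hermite_like (g : M -> 'rV[R]_n -> 'rV[R]_n -> R)
    (J JS : M -> 'rV[R]_n -> 'rV[R]_n) (D DS : covder) : Prop :=
  [/\ statistical g D DS, almost_complex J, almost_complex JS
    & forall p u v, g p (J p u) v = - g p u (JS p v)].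

Definition parallel (D : covder) (J : M -> 'rV[R]_n -> 'rV[R]_n) : Prop :=
  forall p X Y, smooth_vfield_at p X -> smooth_vfield_at p Y ->
    D p (X p) (fun q => J q (Y q)) = J p (D p (X p) Y).

Definition kaehler_like (g : M -> 'rV[R]_n -> 'rV[R]_n -> R)
    (J JS : M -> 'rV[R]_n -> 'rV[R]_n) (D DS : covder) : Prop :=
  hermite_like g J JS D DS /\ parallel D J.

Definition geodesic_with (D : covder) (X : vfield) (zeta : M -> R^o) : Prop :=
  smooth_scalar zeta /\ forall p, D p (X p) X = zeta p *: X p.

Definition geodesic (D : covder) (X : vfield) : Prop :=
  exists zeta, geodesic_with D X zeta.

(* On a Hopf hypersurface nabla_xi xi = eps theta(xi) xi always holds, so
   [geodesic nabla xi] is automatic; theta(xi) = 0 is equivalent to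
   [unit_geodesic nabla xi], the usual meaning of "geodesic vector field". *)
Definition unit_geodesic (D : covder) (X : vfield) : Prop :=
  geodesic_with D X (fun=> 0).

End Fields.

Section Hypersurfaces.
Variables (R : realType) (n : nat) (Mt : manifold R n.+1) (M : manifold R n).
Variable iota : M -> Mt.

Definition tmap (p : M) (v : 'rV[R]_n) : 'rV[R]_n.+1 :=
  dird p v (coord (iota p) \o iota).

Definition immersion : Prop :=
  [/\ continuous iota,
      forall p, smooth_fun_at p (coord (iota p) \o iota)
    & forall p, injective (tmap p)].

Definition induced_metric (gt : Mt -> 'rV[R]_n.+1 -> 'rV[R]_n.+1 -> R) (p : M)
    (u v : 'rV[R]_n) : R :=
  gt (iota p) (tmap p u) (tmap p v).

(* Vector fields of Mt along iota: V p is a tangent vector of Mt at iota p. *)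
Definition along_field := M -> 'rV[R]_n.+1.

(* Components of V in the chart of Mt attached to iota p. *)
Definition along_coord (p : M) (V : along_field) : M -> 'rV[R]_n.+1 :=
  fun q => tcoord (iota p) (iota q) (V q).

Definition smooth_along (V : along_field) : Prop :=
  forall p, smooth_fun_at p (along_coord p V).

(* The covariant derivative along iota of a field V = \sum_i V^i E_i near p,
   with E_i the coordinate fields of Mt in the chart attached to iota p:
   \sum_i (v(V^i) E_i + V^i(p) D_(d iota v) E_i). *)
Definition covder_along (D : covder Mt) (p : M) (v : 'rV[R]_n)
    (V : along_field) : 'rV[R]_n.+1 :=
  dird p v (along_coord p V) +
  D (iota p) (tmap p v) (coord_field (iota p) (V p)).

Definition nondegenerate_hypersurface
    (gt : Mt -> 'rV[R]_n.+1 -> 'rV[R]_n.+1 -> R) (N : along_field) : Prop :=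
  [/\ immersion, nondegenerate (induced_metric gt), smooth_along N,
      forall p v, gt (iota p) (N p) (tmap p v) = 0
    & forall p, `|gt (iota p) (N p) (N p)| = 1].

(* JN and J*N are tangent to M, xi = - JN and xi* = - J*N. *)
Definition tangential_hypersurface
    (gt : Mt -> 'rV[R]_n.+1 -> 'rV[R]_n.+1 -> R)
    (J JS : Mt -> 'rV[R]_n.+1 -> 'rV[R]_n.+1)
    (N : along_field) (xi xiS : vfield M) : Prop :=
  [/\ nondegenerate_hypersurface gt N,
      smooth_vfield xi, smooth_vfield xiS,
      forall p, tmap p (xi p) = - J (iota p) (N p)
    & forall p, tmap p (xiS p) = - JS (iota p) (N p)].

Definition gauss_formula (g : M -> 'rV[R]_n -> 'rV[R]_n -> R) (eps : M -> R)
    (D : covder Mt) (N : along_field) (nabla : covder M)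
    (A : M -> 'rV[R]_n -> 'rV[R]_n) : Prop :=
  forall p X Y, smooth_vfield_at p X -> smooth_vfield_at p Y ->
    covder_along D p (X p) (fun q => tmap q (Y q)) =
    tmap p (nabla p (X p) Y) + (eps p * g p (A p (X p)) (Y p)) *: N p.

Definition weingarten_formula (eps : M -> R) (D : covder Mt) (N : along_field)
    (A : M -> 'rV[R]_n -> 'rV[R]_n) (theta : M -> 'rV[R]_n -> R) : Prop :=
  forall p X, smooth_vfield_at p X ->
    covder_along D p (X p) N =
    - tmap p (A p (X p)) + (eps p * theta p (X p)) *: N p.

Definition gauss_weingarten (gt : Mt -> 'rV[R]_n.+1 -> 'rV[R]_n.+1 -> R)
    (D DS : covder Mt) (N : along_field) (xi xiS : vfield M)
    (nabla nablaS : covder M) (A AS : M -> 'rV[R]_n -> 'rV[R]_n)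
    (theta : M -> 'rV[R]_n -> R) : Prop :=
  let g := induced_metric gt in
  let eps p := g p (xi p) (xiS p) in
  [/\ connection nabla /\ connection nablaS,
      endo_field A /\ endo_field AS,
      one_form theta,
      gauss_formula g eps D N nabla AS /\ weingarten_formula eps D N A theta
    & gauss_formula g eps DS N nablaS A /\
      weingarten_formula eps DS N AS (fun p v => - theta p v)].

End Hypersurfaces.

Definition hopf (R : realType) (n : nat) (M : manifold R n)
    (A AS : M -> 'rV[R]_n -> 'rV[R]_n) (xi xiS : vfield M) : Prop :=
  exists rho rhoS : M -> R^o,
    [/\ smooth_scalar rho, smooth_scalar rhoS,
        forall p, A p (xi p) = rho p *: xi p
      & forall p, AS p (xiS p) = rhoS p *: xiS p].

(* Main.v *)
(* Covariant differentiation along iota commutes with a parallel endomorphism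
   field J. Apply this to N: with JN = - xi, the Gauss formula for D_xi xi on one
   side and J applied to the Weingarten formula for D_xi N on the other give
     nabla_xi xi + c N = rho N + eps theta(xi) xi,
   because J A_N xi = rho J xi = rho N. The tangential part reads
   nabla_xi xi = eps theta(xi) xi, where xi <> 0 and eps = g(N, N) = +-1. *)
Require Import Defs.
From HB Require Import structures.
From mathcomp Require Import all_boot all_order all_algebra.
From mathcomp Require Import all_classical all_reals all_analysis.
Import Order.TTheory GRing.Theory Num.Theory numFieldNormedType.Exports.
Local Open Scope classical_set_scope.
Local Open Scope ring_scope.
(* The library's [coord] (coordinates on a tuple of vectors) shadows the one
   of the charts. *)
Local Notation coord := Defs.coord.

(** * Derivatives in normed modules: locality, chain rule, product rule *)

Lemma near_eq_differentiable (R : numFieldType) (V W : normedModType R)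
    (f g : V -> W) (x : V) :
  (\forall y \near x, f y = g y) -> differentiable f x -> differentiable g x.
Proof.
move=> fg df; have fgx : f x = g x by exact: nbhs_singleton fg.
have [cdf /eqaddoP fo] := (diff_locallyP _ _).1 df.
(* Since [f] and [g] agree near [x], the first-order expansion of [f] is one of [g] as well;
   uniqueness of the differential then gives ['d g x = 'd f x]. *)
have go : g \o shift x = cst (g x) + 'd f x +o_ 0 id.
  apply/eqaddoP => e e0.
  have fg0 : \forall h \near 0, f (h + x) = g (h + x).
    by move: fg; rewrite (near_shift 0); apply: filterS => h; rewrite /= subr0.
  apply: filterS2 fg0 (fo e e0) => h fgh.
  by rewrite !fctE /= fgh fgx.
by apply/diff_locallyP; rewrite (diff_unique cdf go).
Qed.

Lemma derive_comp (R : numFieldType) (U V W : normedModType R)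
    (f : U -> V) (g : V -> W) (x v : U) :
  differentiable f x -> differentiable g (f x) ->
  'D_v (g \o f) x = 'D_('D_v f x) g (f x).
Proof.
move=> df dg; rewrite (deriveE _ df) (deriveE _ dg).
by rewrite (deriveE _ (differentiable_comp df dg)) (diff_comp df dg).
Qed.

Lemma derive_scale (R : realFieldType) (V : normedModType R) (n : nat)
    (f : V -> R^o) (g : V -> 'rV[R]_n) (x v : V) :
  derivable f x v -> derivable g x v ->
  is_derive x v (fun y => f y *: g y) ('D_v f x *: g x + f x *: 'D_v g x).
Proof.
move=> df dg.
have dgi i j : derivable (fun y => g y i j : R^o) x v.
  exact: (derivable_mxP _ _ _).1 dg i j.
(* Entry by entry the claim is the product rule for scalar functions. *)
have fgi i j : (fun y => (f y *: g y) i j) = f * (fun y => g y i j : R^o).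
  by apply/funext => y; rewrite fctE mxE.
have dfg : derivable (fun y => f y *: g y) x v.
  by apply/derivable_mxP => i j; rewrite fgi; exact: derivableM df (dgi i j).
split; first exact: dfg.
apply/matrixP => i j; rewrite (derive_mx dfg) (derive_mx dg) !mxE fgi.
by rewrite (deriveM df (dgi i j)) addrC; congr (_ + _); exact: mulrC.
Qed.

(** * Stability of C^k functions and smooth germs *)

Section Ck.
Context {R : realType} {n : nat}.
Implicit Types (V W : normedModType R) (U : set 'rV[R]_n).

(** Openness of [U] turns equality on [U] into equality near each of its points, so the directional
    derivatives agree on [U] too and the induction on [k] continues. *)
Lemma Ck_eq V k U (f g : 'rV[R]_n -> V) : open U ->
  (forall x, U x -> f x = g x) -> Ck k U f -> Ck k U g.
Proof.
move=> oU; elim: k f g => [|k IH] f g fg /=;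
  have nfg x : U x -> \forall y \near x, f y = g y
    by move=> Ux; apply: filterS (open_nbhs_nbhs (conj oU Ux)) => y /fg.
  move=> cf x Ux; rewrite /prop_for /continuous_at -(fg x Ux).
  apply: cvg_trans (cf x Ux).
  by apply: (@near_eq_cvg _ _ (nbhs x)); exact: nfg.
move=> [df cf]; split=> [x Ux|v].
  exact: near_eq_differentiable (nfg x Ux) (df x Ux).
by apply: IH (cf v) => x Ux; apply: near_eq_derive; exact: nfg.
Qed.

Lemma Ck_subset V k U U' (f : 'rV[R]_n -> V) :
  U' `<=` U -> Ck k U f -> Ck k U' f.
Proof.
move=> sU; elim: k f => [|k IH] f /=; first by move=> cf x /sU; exact: cf.
by move=> [df cf]; split=> [x /sU|v]; [exact: df|apply: IH; exact: cf].
Qed.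

Lemma Ck_cst V k U (a : V) : Ck k U (fun=> a).
Proof.
elim: k a => [|k IH] a /=; first by move=> x _; apply: cst_continuous.
split=> [x _|v]; first exact: differentiable_cst.
rewrite (_ : 'D_v (fun=> a) = fun=> 0) //.
by apply/funext => x; exact: derive_cst.
Qed.

Lemma CkD V k U (f g : 'rV[R]_n -> V) : open U ->
  Ck k U f -> Ck k U g -> Ck k U (fun x => f x + g x).
Proof.
move=> oU; elim: k f g => [|k IH] f g /=.
  by move=> cf cg x Ux; apply: continuousD; [exact: cf|exact: cg].
move=> [df cf] [dg cg]; split=> [x Ux|v].
  by apply: differentiableD; [exact: df|exact: dg].
apply: (Ck_eq _ _ _ (fun x => 'D_v f x + 'D_v g x)) => //; last exact: IH.
by move=> x Ux; rewrite -deriveD //; apply: diff_derivable; [exact: df|exact: dg].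
Qed.

(** A continuous linear map is its own differential, hence commutes with every ['D_v]. *)
Lemma Ck_linear V W k U (L : V -> W) (f : 'rV[R]_n -> V) :
  open U -> linear L -> continuous L -> Ck k U f -> Ck k U (fun x => L (f x)).
Proof.
move=> oU linL cL.
pose linB := GRing.isLinear.Build _ _ _ _ _ linL.
pose Ll : {linear V -> W} := HB.pack L linB.
elim: k f => [|k IH] f /=.
  move=> cf x Ux; apply: continuous_comp; [exact: cf|exact: cL].
have dL y : differentiable L y by exact: (@linear_differentiable _ _ _ Ll y cL).
move=> [df cf]; split=> [x Ux|v].
  exact: (differentiable_comp (df x Ux) (dL (f x))).
apply: (Ck_eq _ _ _ (fun x => L ('D_v f x))) => //; last exact: IH.
move=> x Ux; have dLf := differentiable_comp (df x Ux) (dL (f x)).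
rewrite (deriveE _ (df x Ux)) (deriveE _ dLf).
by rewrite (diff_comp (df x Ux) (dL (f x))) (@diff_lin _ _ _ Ll (f x) cL).
Qed.

Lemma smooth_near_eq V x (f g : 'rV[R]_n -> V) :
  (\forall y \near x, f y = g y) -> smooth_near x f -> smooth_near x g.
Proof.
move=> fg [U [oU Ux] sf].
have [U' [oU' U'x] fgU'] : exists2 U', open_nbhs x U' & U' `<=` [set y | f y = g y].
  by move: (fg); rewrite /prop_near1 nbhsE => -[U' ? ?]; exists U'.
have oUU' : open (U `&` U') by exact: openI.
exists (U `&` U'); first by [].
move=> k; apply: (Ck_eq _ _ _ f) => //; first by move=> y [_ /fgU'].
by apply: Ck_subset (sf k) => y [].
Qed.

Lemma smooth_nearD V x (f g : 'rV[R]_n -> V) :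
  smooth_near x f -> smooth_near x g -> smooth_near x (fun y => f y + g y).
Proof.
move=> [U [oU Ux] sf] [U' [oU' U'x] sg].
have oUU' : open (U `&` U') by exact: openI.
exists (U `&` U'); first by [].
move=> k; apply: CkD => //; first by apply: Ck_subset (sf k) => y [].
by apply: Ck_subset (sg k) => y [].
Qed.

Lemma smooth_near_linear V W x (L : V -> W) (f : 'rV[R]_n -> V) :
  linear L -> continuous L -> smooth_near x f -> smooth_near x (fun y => L (f y)).
Proof. by move=> lL cL [U [oU Ux] sf]; exists U => // k; exact: Ck_linear. Qed.

Lemma smooth_near_differentiable V x (f : 'rV[R]_n -> V) :
  smooth_near x f -> differentiable f x.
Proof. by move=> [U [_ Ux] /(_ 1)[+ _]]; apply. Qed.

End Ck.

(** * Charts, transition maps and components of tangent vectors *)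

Lemma transition_open (R : realType) (n : nat) (M : manifold R n) (p q : M) :
  open (coord p @` (dom p `&` dom q)).
Proof.
(* In the preimage form, openness follows from the continuity of [param p] at each point of the
   chart image. *)
suff -> : coord p @` (dom p `&` dom q) =
    coord p @` dom p `&` param p @^-1` dom q.
  rewrite openE => x [px qx]; apply: filterI.
    by apply: open_nbhs_nbhs; split=> //; exact: coord_open.
  apply: (param_continuous px).
  by apply: open_nbhs_nbhs; split=> //; exact: dom_open.
apply/seteqP; split=> x.
  by move=> [r [pr qr] <-]; split; [exists r|rewrite /= coordK].
by move=> [[r pr <-]] /=; rewrite coordK // => qr; exists r.
Qed.

Section Manifold.
Context {R : realType} {n : nat} {M : manifold R n}.
Implicit Types (p q r : M) (V : normedModType R) (v w : 'rV[R]_n).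

Lemma near_dom p q : dom p q -> \forall r \near q, dom p r.
Proof. by move=> pq; apply: open_nbhs_nbhs; split=> //; exact: dom_open. Qed.

Lemma near_param p q (P : set M) : dom p q ->
  (\forall r \near q, P r) -> \forall x \near coord p q, P (param p x).
Proof.
move=> pq Pq; have px : (coord p @` dom p) (coord p q) by exists q.
by apply: (param_continuous px); rewrite coordK.
Qed.

Lemma near_coord p q : dom p q ->
  \forall x \near coord p q, dom p (param p x) /\ coord p (param p x) = x.
Proof.
move=> pq.
have : nbhs (coord p q) (coord p @` dom p).
  by apply: open_nbhs_nbhs; split; [exact: coord_open|exists q].
by apply: filterS => _ [r pr <-]; rewrite coordK.
Qed.

Lemma transition_differentiable p q r : dom p r -> dom q r ->
  differentiable (coord q \o param p) (coord p r).
Proof.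
move=> pr qr; apply: smooth_near_differentiable.
exists (coord p @` (dom p `&` dom q)); last exact: transition_smooth.
by split; [exact: transition_open|exists r].
Qed.

(** The two transition maps are mutually inverse near [r], so by the chain rule their differentials
    are inverse too. Hence [tcoord p q] and evaluation of [coord_field p] at [q] undo each other. *)
Lemma transitionK p q r w : dom p r -> dom q r ->
  'D_('D_w (coord q \o param p) (coord p r)) (coord p \o param q) (coord q r) = w.
Proof.
move=> pr qr.
have fr : (coord q \o param p) (coord p r) = coord q r by rewrite /= coordK.
have dpq := transition_differentiable _ _ _ pr qr.
have dqp := transition_differentiable _ _ _ qr pr.
rewrite -fr in dqp *; rewrite -(derive_comp _ _ _ _ _ _ _ _ dpq dqp).
rewrite -[RHS](derive_id (coord p r) w); apply: near_eq_derive.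
have near_qr := near_param _ _ _ pr (near_dom _ _ qr).
apply: filterS2 (near_coord _ _ pr) near_qr => x [px xK] qx.
by rewrite /= coordK.
Qed.

Lemma tcoordK p q v : dom p q -> coord_field p (tcoord p q v) q = v.
Proof. by move=> pq; apply: transitionK; first exact: dom_mem. Qed.

Lemma coord_fieldK p q w : dom p q -> tcoord p q (coord_field p w q) = w.
Proof. by move=> pq; apply: transitionK => //; exact: dom_mem. Qed.

Lemma tcoord_id p v : tcoord p p v = v.
Proof.
rewrite -[RHS](derive_id (coord p p) v); apply: near_eq_derive.
by apply: filterS (near_coord _ _ (dom_mem p)) => x [].
Qed.

Lemma coord_field_id p w : coord_field p w p = w.
Proof. by rewrite -[LHS](tcoord_id p) coord_fieldK //; exact: dom_mem. Qed.

Lemma tcoordP p q : dom p q -> linear (tcoord p q).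
Proof.
move=> pq a u v; rewrite /tcoord /dird !deriveE ?linearP //;
  apply: transition_differentiable => //; exact: dom_mem.
Qed.

Lemma coord_fieldP p q : dom p q -> linear ((coord_field p)^~ q).
Proof.
move=> pq a u v; rewrite /coord_field !deriveE ?linearP //;
  apply: transition_differentiable => //; exact: dom_mem.
Qed.

Lemma smooth_fun_at_eq V p (f g : M -> V) : (\forall q \near p, f q = g q) ->
  smooth_fun_at p f -> smooth_fun_at p g.
Proof.
by move=> fg; apply: smooth_near_eq; exact: near_param (dom_mem p) fg.
Qed.

Lemma dird_eq V p v (f g : M -> V) : (\forall q \near p, f q = g q) ->
  dird p v f = dird p v g.
Proof.
by move=> fg; apply: near_eq_derive; exact: near_param (dom_mem p) fg.
Qed.

Lemma smooth_fun_at_cst V p (a : V) : smooth_fun_at p (fun=> a).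
Proof.
exists setT; first by split; [exact: openT|].
by move=> k; exact: Ck_cst.
Qed.

Lemma smooth_fun_at_derivable V p v (f : M -> V) : smooth_fun_at p f ->
  derivable (f \o param p) (coord p p) v.
Proof. by move=> /smooth_near_differentiable; exact: diff_derivable. Qed.

Lemma dird_cst V p v (a : V) : dird p v (fun=> a) = 0.
Proof. exact: derive_cst. Qed.

Lemma dirdD V p v (f g : M -> V) : smooth_fun_at p f -> smooth_fun_at p g ->
  dird p v (fun q => f q + g q) = dird p v f + dird p v g.
Proof. by move=> sf sg; apply: deriveD; exact: smooth_fun_at_derivable. Qed.

Lemma dirdZl p v w (f : M -> R^o) : smooth_fun_at p f ->
  dird p v (fun q => f q *: w) = dird p v f *: w.
Proof.
move=> sf.
have := derive_scale _ _ _ (f \o param p) (fun=> w) (coord p p) v.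
case=> [||_]; first exact: smooth_fun_at_derivable.
  exact: derivable_cst.
by rewrite (derive_cst w) scaler0 addr0.
Qed.

(** Near [p] the components of this field in the chart at [p] are [f] itself. *)
Lemma coord_field_smooth p (f : M -> 'rV[R]_n) : smooth_fun_at p f ->
  smooth_vfield_at p (fun q => coord_field p (f q) q).
Proof.
apply: smooth_fun_at_eq; apply: filterS (near_dom _ _ (dom_mem p)) => q pq.
by rewrite coord_fieldK.
Qed.

End Manifold.

(** * Connections: locality and expansion in a frame *)

Section Connection.
Context {R : realType} {n : nat} {M : manifold R n}.
Variable D : covder M.
Hypothesis connD : connection D.
Implicit Types (p q : M) (u v w : 'rV[R]_n) (X Y : vfield M).

(* Leibniz rule for the indicator function f of {X = Y}: it is constant near p,
   and f X = f Y everywhere. *)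
Lemma covder_eq p v X Y : smooth_vfield_at p X ->
  (\forall q \near p, X q = Y q) -> D p v X = D p v Y.
Proof.
have [_ _ leibniz _] := connD; move=> sX XY.
have sY : smooth_vfield_at p Y.
  by apply: smooth_fun_at_eq sX; apply: filterS XY => q ->.
pose f : M -> R^o := fun q => if `[< X q = Y q >] then 1 else 0.
have f1 : \forall q \near p, (fun=> 1) q = f q.
  by apply: filterS XY => q XYq; rewrite /f; case: asboolP.
have sf : smooth_fun_at p f.
  by apply: (smooth_fun_at_eq _ _ _ _ f1); exact: smooth_fun_at_cst.
have fXY : (fun q => f q *: X q) = (fun q => f q *: Y q).
  by apply/funext => q; rewrite /f; case: asboolP => [->|]; rewrite ?scale0r.
have df0 : dird p v f = 0.
  by rewrite -(dird_eq _ _ _ _ _ f1) dird_cst.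
have := leibniz p v f X sf sX.
rewrite fXY leibniz // df0 !scale0r !add0r -(nbhs_singleton f1) !scale1r.
exact: esym.
Qed.

Lemma covderZ p v (a : R) Y : smooth_vfield_at p Y ->
  D p v (fun q => a *: Y q) = a *: D p v Y.
Proof.
have [_ _ leibniz _] := connD; move=> sY.
rewrite (leibniz p v (fun=> a : R^o)) //; last exact: smooth_fun_at_cst.
by rewrite dird_cst scale0r add0r.
Qed.

(* [E] stands for [coord_field p]; keeping it abstract prevents unification from
   unfolding the directional derivatives that define it. *)
Section Frame.
Context (p : M) (v : 'rV[R]_n) (E : 'rV[R]_n -> vfield M).
Hypothesis linE : \forall q \near p, linear (E^~ q).
Hypothesis Ep : forall w, E w p = w.
Hypothesis smoothE : forall f : M -> 'rV[R]_n, smooth_fun_at p f ->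
  smooth_vfield_at p (fun q => E (f q) q).

Let smoothE_cst w : smooth_vfield_at p (E w).
Proof. exact/smoothE/smooth_fun_at_cst. Qed.

Let covder_frameD u w : D p v (E (u + w)) = D p v (E u) + D p v (E w).
Proof.
have [_ add _ _] := connD.
rewrite -(add _ _ _ _ (smoothE_cst u) (smoothE_cst w)).
apply: covder_eq; first exact: smoothE_cst.
by apply: filterS linE => q lq; have := lq 1 u w; rewrite !scale1r.
Qed.

Let covder_frameZ a u : D p v (E (a *: u)) = a *: D p v (E u).
Proof.
rewrite -(covderZ _ _ _ _ (smoothE_cst u)).
apply: covder_eq; first exact: smoothE_cst.
by apply: filterS linE => q lq; exact: (scalable_linear lq).
Qed.

(** Smoothness is bundled with the formula because the induction over coordinates needs both for
    every partial sum. *)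
Let frame_rule (f : M -> 'rV[R]_n) := smooth_fun_at p f /\
  D p v (fun q => E (f q) q) = dird p v f + D p v (E (f p)).

Let frame_ruleD f g : frame_rule f -> frame_rule g ->
  frame_rule (fun q => f q + g q).
Proof.
have [_ add _ _] := connD; move=> [sf ef] [sg eg].
have sfg : smooth_fun_at p (fun q => f q + g q) by exact: smooth_nearD.
split; first exact: sfg.
have -> : D p v (fun q => E (f q + g q) q) =
    D p v (fun q => E (f q) q + E (g q) q).
  apply: covder_eq; first exact: smoothE.
  by apply: filterS linE => q lq; have := lq 1 (f q) (g q); rewrite !scale1r.
rewrite (add _ _ _ _ (smoothE _ sf) (smoothE _ sg)) covder_frameD.
by rewrite (dirdD _ _ _ _ _ sf sg) ef eg addrACA.
Qed.

Let frame_ruleZ w (f : M -> R^o) : smooth_fun_at p f ->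
  frame_rule (fun q => f q *: w).
Proof.
have [_ _ leibniz _] := connD; move=> sf.
have sfw : smooth_fun_at p (fun q => f q *: w).
  apply: (smooth_near_linear R^o _ _ (fun a => a *: w) _ _ _ sf).
    by move=> a b c; rewrite scalerDl scalerA.
  exact: scalel_continuous.
split; first exact: sfw.
have -> : D p v (fun q => E (f q *: w) q) = D p v (fun q => f q *: E w q).
  apply: covder_eq; first exact: smoothE.
  by apply: filterS linE => q lq; exact: (scalable_linear lq).
(* Leibniz gives [dird p v f *: E w p + f p *: D p v (E w)]; [Ep] and homogeneity bring both terms
   to the required form. *)
rewrite (leibniz _ _ _ _ sf (smoothE_cst w)) covder_frameZ Ep.
by rewrite (dirdZl _ _ _ _ sf).
Qed.

(** Splitting [f] into its coordinates times constant basis vectors reduces the claim to the Leibniz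
    rule for one summand. *)
Lemma covder_frame (f : M -> 'rV[R]_n) : smooth_fun_at p f ->
  D p v (fun q => E (f q) q) = dird p v f + D p v (E (f p)).
Proof.
move=> sf; suff [] : frame_rule f by [].
have -> : f = fun q => \sum_i (f q 0 i : R^o) *: delta_mx 0 i.
  by apply/funext => q; exact: row_sum_delta.
elim: (index_enum _) => [|i r IH].
  (* The empty sum is written as the function 0 times the vector 0, so that [frame_ruleZ] covers
     it. *)
  rewrite (_ : (fun q => _) = (fun q => (fun=> 0 : R^o) q *: 0)).
    exact/frame_ruleZ/smooth_fun_at_cst.
  by apply/funext => q; rewrite big_nil scaler0.
rewrite (_ : (fun q => _) = (fun q => (f q 0 i : R^o) *: delta_mx 0 i +
    \sum_(j <- r) (f q 0 j : R^o) *: delta_mx 0 j)); last first.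
  by apply/funext => q; rewrite big_cons.
apply: frame_ruleD IH; apply: frame_ruleZ.
apply: (smooth_near_linear _ R^o _ (fun u => u 0 i) _ _ _ sf).
  by move=> a u w; rewrite !mxE.
exact: coord_continuous.
Qed.

End Frame.

Lemma covder_coord_field p v (f : M -> 'rV[R]_n) : smooth_fun_at p f ->
  D p v (fun q => coord_field p (f q) q) =
  dird p v f + D p v (coord_field p (f p)).
Proof.
apply: covder_frame.
- by apply: filterS (near_dom _ _ (dom_mem p)) => q; exact: coord_fieldP.
- exact: coord_field_id.
- exact: coord_field_smooth.
Qed.

Lemma smooth_vfield_atN p X :
  smooth_vfield_at p X -> smooth_vfield_at p (fun q => - X q).
Proof.
move=> sX; have : smooth_fun_at p (fun q => - tcoord p q (X q)).
  apply: (smooth_near_linear _ _ _ (@GRing.opp _) _ _ _ sX).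
    by move=> a u w; rewrite scalerN opprD.
  exact: opp_continuous.
apply: smooth_fun_at_eq; apply: filterS (near_dom _ _ (dom_mem p)) => q pq.
by rewrite -scaleN1r -(scalable_linear (tcoordP _ _ pq)) scaleN1r.
Qed.

End Connection.

(** * Differentiation of fields along an immersion *)

Section Along.
Context {R : realType} {n : nat} {Mt : manifold R n.+1} {M : manifold R n}.
Variable iota : M -> Mt.
Hypothesis imm : immersion iota.

Lemma near_iota p (P : set Mt) : (\forall x \near iota p, P x) ->
  \forall q \near p, P (iota q).
Proof. by have [ci _ _] := imm; move=> /ci. Qed.

Lemma tmapP p : linear (tmap iota p).
Proof.
have [_ /(_ p) /smooth_near_differentiable di _] := imm.
by move=> a u v; rewrite /tmap /dird !(deriveE _ di) linearP.
Qed.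

(** Near [p] the map [iota] stays in the chart domain at [iota p], so [F \o iota] factors through
    that chart and the chain rule of normed modules applies. *)
Lemma chain_rule (W : normedModType R) (p : M) v (F : Mt -> W) :
  smooth_fun_at (iota p) F ->
  is_derive (coord p p) v ((F \o iota) \o param p)
    (dird (iota p) (tmap iota p v) F).
Proof.
have [_ /(_ p) /smooth_near_differentiable di _] := imm.
move=> /smooth_near_differentiable dF.
have ip : ((coord (iota p) \o iota) \o param p) (coord p p) =
    coord (iota p) (iota p) by rewrite /= coordK //; exact: dom_mem.
rewrite /dird /tmap /dird -ip in dF *; rewrite -(derive_comp _ _ _ _ _ _ _ _ di dF).
have : derivable ((F \o param (iota p)) \o ((coord (iota p) \o iota) \o param p))
    (coord p p) v.
  exact/diff_derivable/differentiable_comp.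
move=> /derivableP; apply: near_eq_is_derive.
have near_ip := near_iota _ _ (near_dom _ _ (dom_mem (iota p))).
apply: filterS (near_param _ _ _ (dom_mem p) near_ip) => y iy.
by rewrite /= coordK.
Qed.

Lemma along_coord_id p V : along_coord iota p V p = V p.
Proof. exact: tcoord_id. Qed.

(* In the chart at iota p let Jm(x) be the matrix of J at x. The components of JV
   are Jm V, so their derivative is J(v(V)) + v(Jm) V; the second term is the
   difference between D(J E) = J D E, for E the constant-component field through
   V p, and D of the constant-component field through J V p. *)
Lemma covder_along_parallel D J p v V :
  connection D -> endo_field J -> parallel D J ->
  derivable (along_coord iota p V \o param p) (coord p p) v ->
  covder_along iota D p v (fun q => J (iota q) (V q)) =
  J (iota p) (covder_along iota D p v V).
Proof.
move=> connD [linJ smJ] parJ dV; set x0 := iota p; set u := tmap iota p v.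
pose Jm w x := tcoord x0 x (J x (coord_field x0 w x)).
have near_x0 := near_dom _ _ (dom_mem x0).
have Jm_id w : Jm w x0 = J x0 w by rewrite /Jm tcoord_id coord_field_id.
have sJm w : smooth_fun_at x0 (Jm w).
  exact/smJ/coord_field_smooth/smooth_fun_at_cst.
(* The entries of [w] do not depend on [x]: [Jm w] is a fixed combination of the functions
   [Jm (delta_mx 0 i)]. *)
have Jm_sum w x : dom x0 x -> Jm w x = \sum_i w 0 i *: Jm (delta_mx 0 i) x.
  move=> x0x; have linJm : linear (Jm^~ x).
    move=> a b c; rewrite /Jm.
    by rewrite (coord_fieldP _ _ x0x) linJ (tcoordP _ _ x0x).
  pose linB := GRing.isLinear.Build _ _ _ _ _ linJm.
  pose Jl : {linear 'rV[R]_n.+1 -> 'rV[R]_n.+1} := HB.pack (Jm^~ x) linB.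
  rewrite -[LHS]/(Jl w) [in LHS](row_sum_delta w) linear_sum.
  by apply: eq_bigr => i _; rewrite linearZ.
have JmE : D x0 u (fun x => J x (coord_field x0 (V p) x)) =
    dird x0 u (Jm (V p)) + D x0 u (coord_field x0 (J x0 (V p))).
  rewrite -Jm_id -(covder_coord_field _ connD _ _ _ (sJm (V p))).
  apply: covder_eq => //; first exact/smJ/coord_field_smooth/smooth_fun_at_cst.
  by apply: filterS near_x0 => x x0x; rewrite /Jm tcoordK.
(* [parallel] differentiates along a vector field, so [u] is first extended to [coord_field x0 u],
   whose value at [x0] is [u]. *)
have JE : J x0 (D x0 u (coord_field x0 (V p))) =
    D x0 u (fun x => J x (coord_field x0 (V p) x)).
  rewrite -[in LHS](coord_field_id x0 u) -[in RHS](coord_field_id x0 u).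
  apply/esym/parJ; exact/coord_field_smooth/smooth_fun_at_cst.
rewrite /covder_along -/x0 -/u.
have linJD a b : J x0 (a + b) = J x0 a + J x0 b.
  by have := linJ x0 1 a b; rewrite !scale1r.
rewrite linJD JE JmE addrA; congr (_ + _).
(* The terms in [D] have cancelled. What is left is the product rule for the matrix of J times the
   components of V, summed over the coordinates [c i]. *)
pose c i q : R^o := along_coord iota p V q 0 i.
have dc i : is_derive (coord p p) v (c i \o param p)
    (dird p v (along_coord iota p V) 0 i).
  have := derivableP ((derivable_mxP _ _ _).1 dV 0 i).
  by rewrite /dird (derive_mx dV) mxE.
have term i : is_derive (coord p p) v
    (fun y => (c i \o param p) y *: ((Jm (delta_mx 0 i) \o iota) \o param p) y)
    (dird p v (along_coord iota p V) 0 i *: J x0 (delta_mx 0 i) +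
     V p 0 i *: dird x0 u (Jm (delta_mx 0 i))).
  have [d1 <-] := dc i.
  have [d2 <-] := chain_rule _ p v _ (sJm (delta_mx 0 i)).
  have := derive_scale _ _ _ _ _ _ _ d1 d2.
  rewrite {2 3}/comp /= coordK ?Jm_id /c ?along_coord_id //; exact: dom_mem.
have [_ dsum] := is_derive_sum term.
have DJm : dird x0 u (Jm (V p)) =
    \sum_i V p 0 i *: dird x0 u (Jm (delta_mx 0 i)).
  have dJm i : derivable (Jm (delta_mx 0 i) \o param x0) (coord x0 x0) u.
    exact/smooth_fun_at_derivable/sJm.
  have [_ <-] := is_derive_sum (fun i =>
    is_deriveZ (V p 0 i) (derivableP (dJm i))).
  apply: near_eq_derive; apply: filterS (near_coord _ _ (dom_mem x0)) => y [x0y _].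
  by rewrite /= (Jm_sum _ _ x0y) fct_sumE.
rewrite DJm -Jm_id (Jm_sum _ _ (dom_mem x0)) -big_split /=.
under [in RHS]eq_bigr do rewrite Jm_id.
rewrite -dsum; apply: near_eq_derive.
have near_ix := near_param _ _ _ (dom_mem p) (near_iota _ _ near_x0).
apply: filterS near_ix => y x0y.
by rewrite fct_sumE /= -(Jm_sum _ _ x0y) /along_coord /Jm tcoordK.
Qed.
End Along.

(** * Hopf hypersurfaces and the field [nabla_xi xi] *)

Lemma endo_fieldN (R : realType) (n : nat) (M : manifold R n)
    (J : M -> 'rV[R]_n -> 'rV[R]_n) :
  endo_field J -> endo_field (fun p v => - J p v).
Proof.
move=> [linJ smJ]; split=> [p a u v|p X sX]; first by rewrite linJ opprD scalerN.
exact/smooth_vfield_atN/smJ.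
Qed.

(** The theorem differentiates [- J] applied to [N], since this is the pushforward of [xi], to which
    the Gauss formula applies directly. *)
Lemma parallelN (R : realType) (n : nat) (M : manifold R n) (D : covder M)
    (J : M -> 'rV[R]_n -> 'rV[R]_n) :
  connection D -> endo_field J -> parallel D J ->
  parallel D (fun p v => - J p v).
Proof.
move=> connD [_ smJ] parJ p X Y sX sY.
rewrite -(parJ p X Y sX sY) -scaleN1r.
rewrite -(covderZ _ connD _ _ _ _ (smJ _ _ sY)).
by congr (D p (X p)); apply/funext => q; rewrite scaleN1r.
Qed.

Theorem theorem3p11 (R : realType) (n : nat)
    (Mt : manifold R n.+1) (gt : Mt -> 'rV[R]_n.+1 -> 'rV[R]_n.+1 -> R)
    (J JS : Mt -> 'rV[R]_n.+1 -> 'rV[R]_n.+1) (D DS : covder Mt)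
    (M : manifold R n) (iota : M -> Mt) (N : M -> 'rV[R]_n.+1)
    (xi xiS : vfield M) (nabla nablaS : covder M)
    (A AS : M -> 'rV[R]_n -> 'rV[R]_n) (theta : M -> 'rV[R]_n -> R)
    (hKaehler : kaehler_like gt J JS D DS)
    (hTangential : tangential_hypersurface iota gt J JS N xi xiS)
    (hGauss : gauss_weingarten iota gt D DS N xi xiS nabla nablaS A AS theta)
    (hHopf : hopf A AS xi xiS) :
  unit_geodesic nabla xi <-> forall p : M, theta p (xi p) = 0.
Proof.
have [[[[[lin_g sym_g _] _ _] connD _ _ _] [endoJ JK] _ JJS] parJ] := hKaehler.
have [[imm _ smoothN orthN unitN] smooth_xi _ xiE xiSE] := hTangential.
have [_ _ _ [gauss weingarten] _] := hGauss.
have [rho [_ [_ _ Axi _]]] := hHopf.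
have [_ _ inj_tmap] := imm.
set eps : M -> R := fun p => induced_metric iota gt p (xi p) (xiS p).
have gtP x b : scalar (gt x ^~ b) by move=> a u v; exact: lin_g.
have gtZ x a u b : gt x (a *: u) b = a * gt x u b.
  exact: (scalable_linear (gtP x b)).
have gtN x u b : gt x (- u) b = - gt x u b by rewrite -scaleN1r gtZ mulN1r.
have gNN p : gt (iota p) (N p) (N p) != 0.
  by rewrite -normr_eq0 unitN oner_eq0.
have epsE p : eps p = gt (iota p) (N p) (N p).
  (* g(JN, J*N) = - g(JJN, N) = g(N, N). *)
  rewrite /eps /induced_metric xiE xiSE gtN sym_g gtN sym_g opprK.
  by rewrite -[LHS]opprK -JJS JK gtN opprK.
have JZ p a v : J p (a *: v) = a *: J p v.
  exact: (scalable_linear (endoJ.1 p)).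
have tmapZ p a v : tmap iota p (a *: v) = a *: tmap iota p v.
  exact: (scalable_linear (tmapP _ imm p)).
have Jxi p : J (iota p) (tmap iota p (xi p)) = N p.
  by rewrite xiE -scaleN1r JZ scaleN1r JK opprK.
have xi0 p : xi p != 0.
  (* If [xi] vanished at [p], then so would N = J xi, against g(N, N) being nonzero. *)
  apply: contraNneq (gNN p) => xip0; rewrite -[X in gt _ X _]Jxi xip0.
  by rewrite -(scale0r 0) tmapZ scale0r -(scale0r 0) JZ gtZ mul0r.
have tangent_part p u v a b :
    tmap iota p u + a *: N p = b *: N p + tmap iota p v -> u = v.
  (* The difference of the tangent parts is [(b - a) *: N p]. Pairing it with N gives 0 by
     orthogonality, which forces [b = a]. *)
  move=> uv; apply: (inj_tmap p).
  have uvE : tmap iota p u - tmap iota p v = (b - a) *: N p.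
    by rewrite scalerBl -[b *: N p](addrK (tmap iota p v)) -uv addrAC addrK.
  have : (b - a) * gt (iota p) (N p) (N p) = 0.
    by rewrite -gtZ -uvE -(zmod_morphism_linear (tmapP _ imm p)) sym_g orthN.
  move=> /eqP; rewrite mulf_eq0 (negbTE (gNN p)) orbF => /eqP ba.
  by apply/eqP; rewrite -subr_eq0 uvE ba scale0r.
have nabla_xi p : nabla p (xi p) xi = (eps p * theta p (xi p)) *: xi p.
  have dN : derivable (along_coord iota p N \o param p) (coord p p) (xi p).
    exact: smooth_fun_at_derivable.
  have endoNJ := endo_fieldN _ _ _ _ endoJ.
  have parNJ := parallelN _ _ _ _ _ connD endoJ parJ.
  have := covder_along_parallel _ imm _ _ _ _ _ connD endoNJ parNJ dN.
  rewrite (_ : (fun q => - _) = (fun q => tmap iota q (xi q))); last first.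
    by apply/funext => q; rewrite xiE.
  rewrite (gauss p xi xi) // (weingarten p xi) // Axi tmapZ.
  (* The right side is - J(- rho xi + eps theta(xi) N): J xi = N makes the first part normal, - JN =
     xi makes the second tangent. *)
  rewrite -/(eps p) -scaleNr (endoJ.1 (iota p)) Jxi JZ opprD.
  rewrite scaleNr opprK -scalerN -xiE -tmapZ.
  exact: tangent_part.
split=> [[_ geo] p|theta0].
  have := geo p; rewrite nabla_xi scale0r => /eqP.
  (* Neither [xi] nor [eps] vanishes at [p], so the remaining factor is 0. *)
  rewrite scaler_eq0 (negbTE (xi0 p)) orbF epsE mulf_eq0 (negbTE (gNN p)) /=.
  by move=> /eqP.
split=> [p|p]; first exact: smooth_fun_at_cst.
by rewrite nabla_xi theta0 mulr0.
Qed.
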